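(* Let $k\in\mathbb{R}$, $k\neq 0$. Let $(u_n(k))_{n\in\mathbb{Z}}$ and $(v_n(k))_{n\in\mathbb{Z}}$ be absolutely summable sequences of complex numbers depending on the parameter $k$ (absolutely summable for every value of the parameter). Let $\phi_u,\psi_u$ be the functions associated with $u$, and $\phi_v,\psi_v$ those associated with $v$. Then for every $m\in\mathbb{R}$ \[ \int_{-\infty}^\infty e^{-x^2+2imx}\,\phi_u(x,k)\,\psi_v(x,\pi/k)\,dx=\sqrt{\pi}\,e^{-m^2}\,\phi_v(-m,\pi/k)\,\psi_u(m,k). \]
   Context: A sequence $u_n(k)$, $n\in\mathbb{Z}$, is absolutely summable if $\sum_{n\in\mathbb{Z}}|u_n(k)|<\infty$. For such a sequence $u$ (depending on a real parameter $k$) and $x\in\mathbb{R}$, define \[ \phi_u(x,k)=\sum_{n\in\mathbb{Z}}u_n(k)\,e^{-k^2n^2+2knx},\qquad \psi_u(x,k)=\sum_{n\in\mathbb{Z}}u_n(k)\,e^{2iknx}, \] and similarly $\phi_v,\psi_v$ for $v$. Thus $\psi_v(x,\pi/k)$ and $\phi_v(x,\pi/k)$ are formed with the coefficients $v_n(\pi/k)$ and with $k$ replaced by $\pi/k$ in the exponents. *)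

(* Defs.v *)
(* MathComp + MathComp-Analysis; complex numbers are [R[i]], R : realType. *)
From HB Require Import structures.
From mathcomp Require Import all_boot all_order all_algebra complex.
From mathcomp Require Import all_classical all_reals all_analysis.

Set Implicit Arguments.
Unset Strict Implicit.
Unset Printing Implicit Defensive.

Import Order.TTheory GRing.Theory Num.Theory.
Import numFieldNormedType.Exports.

Local Open Scope classical_set_scope.
Local Open Scope ring_scope.
Local Open Scope complex_scope.

Section ComplexAnalysis.
Context {R : realType}.

(* [complex R] carries no canonical topology by itself; through [numFieldType]
   it receives the topology of its modulus. *)
Local Notation C := (R[i] : numFieldType).

Definition cexp (z : R[i]) : R[i] :=
  (expR (complex.Re z) * cos (complex.Im z))
    +i* (expR (complex.Re z) * sin (complex.Im z)).

Definition abs_summable (a : int -> R[i]) : Prop :=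
  (\esum_(n in [set: int]) (ComplexField.Normc.normc (a n))%:E < +oo)%E.

(* The two one-sided series converge separately; [Negz n] is [- n.+1], so the
   index 0 is counted once. *)
Definition zsum (a : int -> R[i]) : R[i] :=
  limn (series (fun n : nat => a (Posz n) : C))
  + limn (series (fun n : nat => a (Negz n) : C)).

Definition cintegrable d (T : measurableType d)
    (mu : {measure set T -> \bar R}) (D : set T) (f : T -> R[i]) : Prop :=
  mu.-integrable D (fun x => (complex.Re (f x))%:E)
  /\ mu.-integrable D (fun x => (complex.Im (f x))%:E).

Definition cintegral d (T : measurableType d)
    (mu : {measure set T -> \bar R}) (D : set T) (f : T -> R[i]) : R[i] :=
  (\int[mu]_(x in D) complex.Re (f x)) +i* (\int[mu]_(x in D) complex.Im (f x)).

(* The coefficients are families [u k n]: a real parameter [k], then the index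
   [n]. The parameter at which the coefficients are evaluated is also the one
   occurring in the exponents. *)
Definition phi (u : R -> int -> R[i]) (x k : R) : R[i] :=
  zsum (fun n => u k n *
    (expR (- (k ^+ 2 * n%:~R ^+ 2) + 2 * k * n%:~R * x))%:C).

Definition psi (u : R -> int -> R[i]) (x k : R) : R[i] :=
  zsum (fun n => u k n * cexp (0 +i* (2 * k * n%:~R * x))).

End ComplexAnalysis.

(* Main.v *)
Require Import Defs.
From HB Require Import structures.
From mathcomp Require Import all_boot all_order all_algebra complex.
From mathcomp Require Import all_classical all_reals all_analysis.
From mathcomp Require Import measurable_realfun ring lra.

Set Implicit Arguments.
Unset Strict Implicit.
Unset Printing Implicit Defensive.

Import Order.TTheory GRing.Theory Num.Theory.
Import numFieldNormedType.Exports.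

Local Open Scope classical_set_scope.
Local Open Scope ring_scope.
Local Open Scope complex_scope.

(** Completing the square turns [exp(-x^2) exp(-k^2 n^2 + 2 k n x)] into
    [exp(-(x - k n)^2)], so with [q = pi / k] the integrand is the double series
    of the terms [u_n v_l exp(-(x - k n)^2 + 2 i (m + q l) x)]. Each of these
    is a Gaussian centred at [s = k n] times a pure wave, and its integral is
    given by the Fourier transform of the Gaussian
    ([cintegral_gauss_wave]):
      [sqrt pi * exp(-(m + q l)^2) * exp(2 i (m + q l) k n)].
    Since [q k = pi], the phase [2 q l k n = 2 pi l n] is a multiple of [2 pi]
    and disappears: this is the only point where the reciprocal parameters
    [k] and [pi / k] meet. What is left factors into a function of [n] and a
    function of [l]; expanding [exp(-(m + q l)^2)] gives
    [exp(-m^2)] times the [l]-th term of [phi v (- m) q], and [exp(2 i m k n)]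
    belongs to the [n]-th term of [psi u m k].

    The two summations are exchanged with the integral one after the other
    ([cintegral_zsum_gauss]), so that no double series occurs: first over [n],
    with [psi v x q] kept as a bounded factor, then over [l] for a fixed [n].
    In both cases the terms are dominated by [b_j exp(-(x - s_j)^2)] with [b]
    summable. The Gaussians all have the same integral [sqrt pi] and are
    bounded by 1, which makes the dominating series converge at every point
    and be integrable.

    The Fourier transform comes from a differential equation. Put
    [J(a) = int exp(-(x - s)^2) cos(2 a (x - s) + th) dx]. Differentiating under
    the integral, and integrating by parts in the form that a total derivative
    vanishing at both ends has integral zero, gives [J' = - 2 a J]; hence
    [J(a) exp(a^2)] is constant ([gauss_cosE]). *)

Local Notation normc := (@ComplexField.Normc.normc _).
Local Notation Re := (@complex.Re _).
Local Notation Im := (@complex.Im _).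

(** * Fourier transform of the Gaussian *)

Section Gauss.
Context {R : realType}.
Notation mu := (@lebesgue_measure R).
Implicit Types (s a c x th : R).

(** The variance 1/2, i.e. standard deviation [(Num.sqrt 2)^-1], makes the
    normal density proportional to a translate of [gauss_fun]; the known mass of
    that density for every mean replaces a translation of the integral. *)
Lemma gauss_funB_normal s x :
  gauss_fun (x - s) = normal_fun s (Num.sqrt 2)^-1 x.
Proof.
rewrite /gauss_fun /normal_fun; congr expR.
by rewrite exprVn sqr_sqrtr// -mulr_natr mulVf// divr1.
Qed.

Lemma continuous_gauss_funB s : continuous (fun x => gauss_fun (x - s)).
Proof.
move=> x; apply: continuous_comp; last exact: continuous_gauss_fun.
by apply: cvgB; [exact: cvg_id|exact: cvg_cst].
Qed.

Lemma integrable_normal_fun s c : c != 0 ->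
  mu.-integrable [set: R] (EFin \o normal_fun s c).
Proof.
move=> c0; have h := integrable_normal_pdf s c.
have -> : (EFin \o normal_fun s c) =
   (fun x => ((normal_peak c)^-1)%:E * (normal_pdf s c x)%:E)%E.
  apply/funext => x /=; rewrite normal_pdfE// -EFinM mulKf//.
  by rewrite gt_eqF// normal_peak_gt0.
exact: integrableZl.
Qed.

Lemma integrable_gauss_funB s :
  mu.-integrable [set: R] (EFin \o (fun x => gauss_fun (x - s))).
Proof.
have -> : (fun x => gauss_fun (x - s)) = normal_fun s (Num.sqrt 2)^-1.
  by apply/funext => x; exact: gauss_funB_normal.
apply: integrable_normal_fun.
by rewrite invr_eq0 sqrtr_eq0 -ltNge.
Qed.

Lemma Rintegral_gauss_funB s :
  \int[mu]_x gauss_fun (x - s) = Num.sqrt pi.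
Proof.
set c : R := (Num.sqrt 2)^-1.
have c0 : c != 0 by rewrite invr_eq0 sqrtr_eq0 -ltNge.
have -> : (fun x => gauss_fun (x - s)) =
   (fun x => (normal_peak c)^-1 * normal_pdf s c x).
  apply/funext => x /=; rewrite normal_pdfE// mulKf ?gauss_funB_normal//.
  by rewrite gt_eqF// normal_peak_gt0.
rewrite RintegralZl//; last exact: integrable_normal_pdf.
rewrite /Rintegral integral_normal_pdf mulr1 invrK /c.
by rewrite exprVn sqr_sqrtr// -mulr_natr mulrAC mulVf// mul1r.
Qed.

Lemma cvg_gauss_fun_nat s :
  gauss_fun (n%:R - s) @[n --> \oo] --> (0 : R).
Proof.
apply: (cvg_comp (fun n : nat => n%:R - s) gauss_fun); last exact: cvg_gauss_fun.
by apply: (cvg_comp (fun n : nat => n%:R : R) (fun y : R => y - s));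
  [exact: cvgr_idn|exact: cvg_addrr].
Qed.

(** This is integration by parts over the whole line: the integral over
    [[- n, n]] is [F n - F (- n)], and it tends to the integral of [f] because
    [f] dominates its own truncations. *)
Lemma Rintegral_derive_eq0 (F f : R -> R) :
  (forall x, is_derive x 1 F (f x)) -> continuous f ->
  mu.-integrable [set: R] (EFin \o f) ->
  F n%:R @[n --> \oo] --> (0 : R) -> F (- n%:R) @[n --> \oo] --> (0 : R) ->
  \int[mu]_x f x = 0.
Proof.
move=> dF cf intf F0 FN0.
have mf : measurable_fun [set: R] f by exact: continuous_measurable_fun.
pose D n : set R := [set` `[- n%:R, n%:R : R]].
pose g n : R -> \bar R := (EFin \o f) \_ (D n).
(* Any fixed x lies in [- n, n] for large n, after which g n x = f x. *)
have cvgg : {ae mu, forall x, setT x -> g^~ x @ \oo --> (EFin \o f) x}.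
  apply: aeW => x _; apply: cvg_near_cst; near=> n.
  rewrite /g /patch mem_set//= /D/= in_itv/= -ler_norml.
  by near: n; exact: nbhs_infty_ger.
have gle : {ae mu, forall x n, setT x -> (`|g n x| <= `|(EFin \o f) x|)%E}.
  apply: aeW => x n _; rewrite /g /patch; case: ifP => //= _.
  by rewrite normr0 lee_fin.
have mg n : measurable_fun [set: R] (g n).
  apply/(measurable_restrictT _ _).1 => //; first exact: measurable_itv.
  by apply: measurable_funTS; exact/measurable_EFinP.
have mEf : measurable_fun [set: R] (EFin \o f) by exact/measurable_EFinP.
have [_ _ cvgI] := @dominated_convergence _ _ _ mu _ measurableT g _ _ mg mEf
  cvgg (integrable_abse intf) gle.
have Ig n : (0 < n)%N ->
  (\int[mu]_x g n x = (F n%:R)%:E - (F (- n%:R))%:E)%E.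
  move=> n0; rewrite -integral_mkcond /=.
  have cF : continuous F.
    by move=> x; apply/differentiable_continuous/derivable1_diffP.
  apply: continuous_FTC2.
  - by rewrite ltrNl (@lt_trans _ _ 0)// ?oppr_lt0 ltr0n.
  - exact: continuous_subspaceT.
  - by split => //; [exact/cvg_at_right_filter/cF|exact/cvg_at_left_filter/cF].
  - by move=> x _; rewrite derive1E; exact: derive_val.
have cvg0 : (\int[mu]_x g n x)%E @[n --> \oo] --> 0%E.
  apply: (@cvg_trans _ ((F n%:R - F (- n%:R))%:E @[n --> \oo])).
    apply: near_eq_cvg; near=> n; rewrite Ig//.
    by near: n; exact: nbhs_infty_gt.
  apply: cvg_EFin; first exact: nearW.
  by rewrite -[X in _ --> X](subr0 0); exact: cvgB.
have -> : \int[mu]_x f x = fine (\int[mu]_x (f x)%:E)%E by [].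
by rewrite (cvg_unique _ cvgI cvg0).
Unshelve. all: end_near. Qed.

Lemma is_derive_gauss_cos_freq s th x a :
  is_derive a 1 (fun a => gauss_fun (x - s) * cos (2 * a * (x - s) + th))
    (gauss_fun (x - s) * (- (2 * (x - s)) * sin (2 * a * (x - s) + th))).
Proof.
have h : is_derive a 1 (fun a => 2 * a * (x - s) + th) (2 * (x - s)).
  apply: is_derive_eq.
  by rewrite /GRing.scale /=; ring.
have h2 := @is_derive1_comp _ _ (fun a => 2 * a * (x - s) + th) _ _ _
    (is_derive_cos (2 * a * (x - s) + th)) h.
have h3 := is_deriveZ (gauss_fun (x - s)) h2.
apply: (is_derive_eq h3).
rewrite /GRing.scale /=; ring.
Qed.

(** The two terms of this derivative are the integrands of [J'] and of
    [2 a J], where [J] is the integral [gauss_cos] below. *)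
Lemma is_derive_gauss_sin s th a x :
  is_derive x 1 (fun x => gauss_fun (x - s) * sin (2 * a * (x - s) + th))
   (gauss_fun (x - s) * (- (2 * (x - s)) * sin (2 * a * (x - s) + th))
    + 2 * a * (gauss_fun (x - s) * cos (2 * a * (x - s) + th))).
Proof.
have h : is_derive x 1 (fun x => 2 * a * (x - s) + th) (2 * a).
  apply: is_derive_eq.
  by rewrite /GRing.scale /=; ring.
have h2 := @is_derive1_comp _ _ (fun x => 2 * a * (x - s) + th) _ _ _
    (is_derive_sin (2 * a * (x - s) + th)) h.
have e : is_derive x 1 (fun x => - (x - s) ^+ 2) (- (2 * (x - s))).
  apply: is_derive_eq.
  rewrite /GRing.scale /=; ring.
have e2 := @is_derive1_comp _ _ (fun x => - (x - s) ^+ 2) _ _ _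
    (is_derive_expR (- (x - s) ^+ 2)) e.
apply: (is_derive_eq (is_deriveM e2 h2)).
rewrite /GRing.scale /= /gauss_fun; ring.
Qed.

Lemma integrable_gauss_bounded s c (h : R -> R) :
  measurable_fun [set: R] h -> (forall x, `|h x| <= c) ->
  mu.-integrable [set: R] (EFin \o (fun x => gauss_fun (x - s) * h x)).
Proof.
move=> mh hc; apply: (@le_integrable _ _ _ mu _ measurableT _
    (fun x => c%:E * (gauss_fun (x - s))%:E)%E).
- apply/measurable_EFinP; apply: measurable_funM => //.
  by apply: continuous_measurable_fun; exact: continuous_gauss_funB.
- move=> x _; rewrite -EFinM /= !normrM lee_fin mulrC.
  by rewrite ler_wpM2r// (le_trans (hc x))// ler_norm.
- by apply: integrableZl => //; exact: integrable_gauss_funB.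
Qed.

(** The majorant of the derivative in the frequency. The polynomial factor is
    absorbed by halving the exponent: [|y| <= 1 + y^2 / 2 <= exp(y^2 / 2)], which
    leaves the standard normal density. *)
Lemma integrable_gauss_mulr_norm s :
  mu.-integrable [set: R]
    (EFin \o (fun x => gauss_fun (x - s) * (2 * `|x - s|))).
Proof.
apply: (@le_integrable _ _ _ mu _ measurableT _
    (fun x => 2%:E * (normal_fun s 1 x)%:E)%E).
- apply/measurable_EFinP; apply: measurable_funM => //.
    by apply: continuous_measurable_fun; exact: continuous_gauss_funB.
  apply: measurable_funM => //; apply: measurableT_comp => //.
  exact: measurable_funB.
- move=> x _; rewrite -EFinM /= lee_fin.
  set y := x - s.
  rewrite !normrM normr_id (ger0_norm (gauss_fun_ge0 _)).
  rewrite (ger0_norm (normal_fun_ge0 _ _ _)) mulrCA; apply: ler_wpM2l => //.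
  have -> : normal_fun s 1 x = gauss_fun y * expR (y ^+ 2 / 2).
    rewrite /normal_fun /gauss_fun -expRD -/y; congr expR; by field.
  apply: ler_wpM2l; first exact: gauss_fun_ge0.
  apply: le_trans (expR_ge1Dx _).
  rewrite -[y ^+ 2]real_normK ?num_real//.
  have := sqr_ge0 (`|y| - 1); lra.
- by apply: integrableZl => //; exact: (integrable_normal_fun _ (oner_neq0 R)).
Qed.

(** The phase is measured from the centre [s], so that the frequency derivative
    produces the factor [x - s] which also comes from differentiating the
    Gaussian. The free phase [th] gives cosine and sine transforms together. *)
Definition gauss_cos s th a :=
  \int[mu]_x (gauss_fun (x - s) * cos (2 * a * (x - s) + th)).

Lemma affine_continuous a s th : continuous (fun x => a * (x - s) + th).
Proof.
move=> x; apply: cvgD; last exact: cvg_cst.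
by apply: cvgM; [exact: cvg_cst|apply: cvgB; [exact: cvg_id|exact: cvg_cst]].
Qed.

Lemma continuous_cos_affine a s th : continuous (fun x => cos (a * (x - s) + th)).
Proof.
move=> x; apply: continuous_comp; first exact: affine_continuous.
exact: continuous_cos.
Qed.

Lemma continuous_sin_affine a s th : continuous (fun x => sin (a * (x - s) + th)).
Proof.
move=> x; apply: continuous_comp; first exact: affine_continuous.
exact: continuous_sin.
Qed.

Lemma integrable_gauss_cos s th a :
  mu.-integrable [set: R]
    (EFin \o (fun x => gauss_fun (x - s) * cos (2 * a * (x - s) + th))).
Proof.
apply: (@integrable_gauss_bounded _ 1); last first.
  by move=> x; rewrite ler_norml cos_geN1 cos_le1.
by apply: continuous_measurable_fun; exact: continuous_cos_affine.
Qed.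

Lemma integrable_gauss_sin_mulr s th a :
  mu.-integrable [set: R] (EFin \o (fun x =>
    gauss_fun (x - s) * (- (2 * (x - s)) * sin (2 * a * (x - s) + th)))).
Proof.
apply: (@le_integrable _ _ _ mu _ measurableT _ _ _ _
  (integrable_gauss_mulr_norm s)).
- apply/measurable_EFinP; apply: measurable_funM => //.
    by apply: continuous_measurable_fun; exact: continuous_gauss_funB.
  apply: measurable_funM => //.
    do 2 apply: measurableT_comp => //; exact: measurable_funB.
  by apply: continuous_measurable_fun; exact: continuous_sin_affine.
- move=> x _; rewrite /= lee_fin !normrM normrN normrM normr_id; apply: ler_wpM2l => //.
  by rewrite ler_piMr// ler_norml sin_geN1 sin_le1.
Qed.

Lemma Rintegral_gauss_sin_mulr s th a :
  \int[mu]_x (gauss_fun (x - s) * (- (2 * (x - s)) * sin (2 * a * (x - s) + th)))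
  = - (2 * a) * gauss_cos s th a.
Proof.
apply/eqP; rewrite mulNr -addr_eq0 -RintegralZl//; last exact: integrable_gauss_cos.
rewrite -RintegralD//; last first.
- rewrite [X in _.-integrable _ X](_ : _ = fun x => (2 * a)%:E *
     (gauss_fun (x - s) * cos (2 * a * (x - s) + th))%:E)%E.
    by apply: integrableZl => //; exact: integrable_gauss_cos.
  by apply/funext => x; rewrite -EFinM.
- exact: integrable_gauss_sin_mulr.
apply/eqP; apply: Rintegral_derive_eq0.
- by move=> x; exact: is_derive_gauss_sin.
- move=> x; apply: cvgD.
    apply: cvgM; first exact: continuous_gauss_funB.
    apply: cvgM; last exact: continuous_sin_affine.
    by apply: cvgN; apply: cvgM; [exact: cvg_cst|
      apply: cvgB; [exact: cvg_id|exact: cvg_cst]].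
  apply: cvgM; first exact: cvg_cst.
  by apply: cvgM; [exact: continuous_gauss_funB|exact: continuous_cos_affine].
- rewrite [X in _.-integrable _ X](_ : _ = fun x =>
     (gauss_fun (x - s) * (- (2 * (x - s)) * sin (2 * a * (x - s) + th)))%:E +
     (2 * a)%:E * (gauss_fun (x - s) * cos (2 * a * (x - s) + th))%:E)%E; last first.
    by apply/funext => x; rewrite -EFinM -EFinD.
  apply: integrableD => //; first exact: integrable_gauss_sin_mulr.
  by apply: integrableZl => //; exact: integrable_gauss_cos.
- apply: (@norm_cvg0 _ R).
  apply: (@squeeze_cvgr _ _ _ _ (cst 0) (fun n : nat => gauss_fun (n%:R - s))).
  + apply: nearW => n /=; rewrite normr_ge0 normrM.
    rewrite (ger0_norm (gauss_fun_ge0 _)) ler_piMr ?gauss_fun_ge0//.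
    by rewrite ler_norml sin_geN1 sin_le1.
  + exact: cvg_cst.
  + exact: cvg_gauss_fun_nat.
- apply: (@norm_cvg0 _ R).
  apply: (@squeeze_cvgr _ _ _ _ (cst 0) (fun n : nat => gauss_fun (n%:R - - s))).
  + apply: nearW => n /=; rewrite normr_ge0 normrM.
    have -> : gauss_fun (n%:R - - s) = gauss_fun (- n%:R - s).
      by rewrite /gauss_fun -sqrrN; congr (expR (- _ ^+ 2)); ring.
    rewrite (ger0_norm (gauss_fun_ge0 _)) ler_piMr ?gauss_fun_ge0//.
    by rewrite ler_norml sin_geN1 sin_le1.
  + exact: cvg_cst.
  + exact: cvg_gauss_fun_nat.
Qed.

Lemma is_derive_gauss_cos s th a :
  is_derive a 1 (gauss_cos s th) (- (2 * a) * gauss_cos s th a).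
Proof.
pose f c x := gauss_fun (x - s) * cos (2 * c * (x - s) + th).
have d1 c x : partial1of2 f c x =
    gauss_fun (x - s) * (- (2 * (x - s)) * sin (2 * c * (x - s) + th)).
  rewrite partial1of2E.
  by case: (is_derive_gauss_cos_freq s th x c).
have aI : `]a - 1, a + 1[%classic a.
  by rewrite /= in_itv/= ltrBlDr ltrDl ltr01.
have intf c : `]a - 1, a + 1[%classic c -> mu.-integrable setT (EFin \o f c).
  by move=> _; exact: integrable_gauss_cos.
have df c x : `]a - 1, a + 1[%classic c -> [set: R] x -> derivable (f ^~ x) c 1.
  by move=> _ _; case: (is_derive_gauss_cos_freq s th x c).
have G0 x : 0 <= gauss_fun (x - s) * (2 * `|x - s|).
  by rewrite mulr_ge0 ?gauss_fun_ge0// mulr_ge0.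
have Gub c x : `]a - 1, a + 1[%classic c -> [set: R] x ->
    `|partial1of2 f c x| <= gauss_fun (x - s) * (2 * `|x - s|).
  move=> _ _; rewrite d1 normrM (ger0_norm (gauss_fun_ge0 _)).
  apply: ler_wpM2l; first exact: gauss_fun_ge0.
  rewrite normrM normrN normrM ger0_norm//.
  by rewrite ler_piMr// ?mulr_ge0// ler_norml sin_geN1 sin_le1.
apply: DeriveDef.
  exact: (derivable_under_integral measurableT aI intf df G0
    (integrable_gauss_mulr_norm s) Gub).
rewrite -derive1E (differentiation_under_integral measurableT aI intf df G0
    (integrable_gauss_mulr_norm s) Gub).
rewrite -Rintegral_gauss_sin_mulr.
by apply: eq_Rintegral => x _; rewrite d1.
Qed.

(** [gauss_cos s th] solves [J' = - 2 a J], so its product with [exp(a^2)] is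
    constant, equal to its value at [a = 0]. *)
Lemma gauss_cosE s th a :
  gauss_cos s th a = Num.sqrt pi * gauss_fun a * cos th.
Proof.
have dz c : is_derive c 1 (fun c => gauss_cos s th c * expR (c ^+ 2)) 0.
  have e : is_derive c 1 (fun c => c ^+ 2) (2 * c).
    by apply: is_derive_eq; rewrite /GRing.scale /=; ring.
  have e2 := @is_derive1_comp _ _ (fun c => c ^+ 2) _ _ _
    (is_derive_expR (c ^+ 2)) e.
  apply: (is_derive_eq (is_deriveM (is_derive_gauss_cos s th c) e2)).
  by rewrite /GRing.scale /=; ring.
have := is_derive_0_is_cst a 0 dz.
rewrite expr0n/= expR0 mulr1 => h.
have -> : gauss_cos s th a = gauss_fun a * (gauss_cos s th a * expR (a ^+ 2)).
  by rewrite mulrCA /gauss_fun -expRD addNr expR0 mulr1.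
rewrite h /gauss_cos -mulrA mulrCA; congr (_ * _).
under eq_Rintegral do rewrite mulr0 mul0r add0r.
by rewrite RintegralZr// ?Rintegral_gauss_funB//; exact: integrable_gauss_funB.
Qed.

End Gauss.

(** * Dominated series of real functions *)

Section RealSeries.
Context {R : realType}.
Implicit Types (a b : nat -> R).

Lemma cvg_series_dominated a b :
  (forall n, `|a n| <= b n) -> cvgn (series b) -> cvgn (series a).
Proof.
move=> ab cb; apply: normed_cvg; apply: series_le_cvg cb => // n; first exact: normr_ge0.
exact: le_trans (normr_ge0 _) (ab n).
Qed.

Lemma norm_lim_series_le a b :
  (forall n, `|a n| <= b n) -> cvgn (series b) ->
  `|limn (series a)| <= limn (series b).
Proof.
move=> ab cb.
have b0 n : 0 <= b n by exact: le_trans (normr_ge0 _) (ab n).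
have ca : cvgn [normed series a].
  by apply: series_le_cvg cb => // n; exact: normr_ge0.
apply: le_trans (lim_series_norm ca) _.
exact: lim_series_le ca cb ab.
Qed.

(** Dominated convergence for the partial sums, with majorant [\sum_n h n].
    That majorant is integrable by monotone convergence, its integral being
    [\sum_n \int h n]. The pointwise convergence of [\sum_n h n] is required at
    every point, so that both limits are genuine everywhere. *)
Lemma integral_series_dominated d (T : measurableType d)
    (mu : {measure set T -> \bar R}) (g h : nat -> T -> R) :
  (forall n, measurable_fun setT (g n)) ->
  (forall n x, `|g n x| <= h n x) ->
  (forall n, mu.-integrable setT (EFin \o h n)) ->
  (forall x, cvgn (series (h ^~ x))) ->
  cvgn (series (fun n => \int[mu]_x h n x)) ->
  mu.-integrable setT (EFin \o (fun x => limn (series (g ^~ x)))) /\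
  \int[mu]_x limn (series (g ^~ x)) =
    limn (series (fun n => \int[mu]_x g n x)).
Proof.
move=> mg gh ih ch cih.
have h0 n x : 0 <= h n x by exact: le_trans (normr_ge0 _) (gh n x).
have ig n : mu.-integrable setT (EFin \o g n).
  apply: le_integrable (ih n) => //; first exact/measurable_EFinP.
  by move=> x _; rewrite /= lee_fin (ger0_norm (h0 _ _)).
have cg x : cvgn (series (g ^~ x)) by exact: cvg_series_dominated (ch x).
have mh n : measurable_fun setT (h n).
  by apply/measurable_EFinP; exact: measurable_int (ih n).
pose H x := limn (series (h ^~ x)).
have mH : measurable_fun setT H.
  apply: (measurable_fun_cvg (h := fun n x => series (h ^~ x) n)).
    by move=> n; exact: measurable_sum.
  by move=> x _; exact: ch.
have iH : mu.-integrable setT (EFin \o H).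
  apply/integrableP; split; first exact/measurable_EFinP.
  have HE x : (`|(EFin \o H) x| = \sum_(n <oo) (h n x)%:E)%E.
    rewrite /= ger0_norm; last first.
      by apply: limr_ge => //; apply: nearW => n; exact: sumr_ge0.
    rewrite /H -EFin_lim//; congr (limn _); apply/funext => n /=.
    by rewrite /series/= sumEFin.
  under eq_integral do rewrite HE.
  rewrite integral_nneseries//; last 2 first.
  - by move=> n; exact/measurable_EFinP.
  - by move=> n x _; rewrite lee_fin.
  rewrite [ltLHS](_ : _ = (limn (series (fun n => \int[mu]_x h n x)))%:E) ?ltry//.
  rewrite -EFin_lim//; congr (limn _); apply/funext => n /=.
  rewrite /series/= -sumEFin; apply: eq_bigr => i _.
  rewrite /Rintegral fineK//. exact: (integrable_fin_num _ (ih i)).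
pose s n x := (series (g ^~ x) n)%:E.
have ms n : measurable_fun setT (s n).
  by apply/measurable_EFinP; exact: measurable_sum.
have ml : measurable_fun setT (EFin \o (fun x => limn (series (g ^~ x)))).
  apply/measurable_EFinP.
  apply: (measurable_fun_cvg (h := fun n x => series (g ^~ x) n)).
    by move=> n; exact: measurable_sum.
  by move=> x _; exact: cg.
have sl : {ae mu, forall x, setT x ->
    s ^~ x @ \oo --> (EFin \o (fun x => limn (series (g ^~ x)))) x}.
  by apply: aeW => x _; apply: cvg_EFin; [exact: nearW|exact: cg].
have sH : {ae mu, forall x n, setT x -> (`|s n x| <= (EFin \o H) x)%E}.
  apply: aeW => x n _; rewrite /s /= lee_fin.
  apply: (@le_trans _ _ (series (h ^~ x) n)).
    by rewrite (le_trans (ler_norm_sum _ _ _))// ler_sum.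
  apply: nondecreasing_cvgn_le => //.
  by apply: nondecreasing_series => ? _ _.
have [il _ cl] := dominated_convergence measurableT ms ml sl iH sH.
split => //; apply/esym/cvg_lim => //.
rewrite [X in X @ _ --> _](_ : _ = fine \o (fun n => \int[mu]_x s n x)%E).
  apply: fine_cvg; rewrite fineK; last exact: integrable_fin_num il.
  exact: cl.
apply/funext => n /=.
rewrite /s /series/=.
under eq_integral do rewrite -sumEFin.
rewrite integral_sum//.
under [in RHS]eq_bigr do rewrite -(fineK (integrable_fin_num measurableT (ig _))).
by rewrite sumEFin.
Qed.

End RealSeries.

(** * Complex series indexed by the integers *)

Section ComplexSeries.
Context {R : realType}.
Local Notation C := (R[i] : numFieldType).
Implicit Types (a : nat -> R[i]) (z w : R[i]).

Lemma Re_addc z w : Re (z + w) = Re z + Re w. Proof. by move: z w => [? ?] [? ?]. Qed.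
Lemma Im_addc z w : Im (z + w) = Im z + Im w. Proof. by move: z w => [? ?] [? ?]. Qed.
Lemma Re_mulc z w : Re (z * w) = Re z * Re w - Im z * Im w.
Proof. by move: z w => [? ?] [? ?]. Qed.
Lemma Im_mulc z w : Im (z * w) = Re z * Im w + Im z * Re w.
Proof. by move: z w => [? ?] [? ?]. Qed.

Lemma Re_sum a n : Re (series (a : nat -> C) n) = series (Re \o a) n.
Proof. by rewrite /series/=; elim/big_ind2: _ => // x y z w <- <-; rewrite Re_addc. Qed.

Lemma Im_sum a n : Im (series (a : nat -> C) n) = series (Im \o a) n.
Proof. by rewrite /series/=; elim/big_ind2: _ => // x y z w <- <-; rewrite Im_addc. Qed.

Lemma normc_sqrtE z : normc z = Num.sqrt (Re z ^+ 2 + Im z ^+ 2).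
Proof. by case: z. Qed.

Lemma normc_ge0 z : 0 <= normc z. Proof. by rewrite normc_sqrtE. Qed.

Lemma normr_Re_le z : `|Re z| <= normc z.
Proof. by rewrite normc_sqrtE -sqrtr_sqr ler_wsqrtr// lerDl sqr_ge0. Qed.

Lemma normr_Im_le z : `|Im z| <= normc z.
Proof. by rewrite normc_sqrtE -sqrtr_sqr ler_wsqrtr// lerDr sqr_ge0. Qed.

Lemma normc_le_ReIm z : normc z <= `|Re z| + `|Im z|.
Proof.
rewrite normc_sqrtE -[leRHS]ger0_norm ?addr_ge0// -sqrtr_sqr ler_wsqrtr//.
rewrite sqrrD !real_normK ?num_real// lerD2r lerDl.
by rewrite mulrn_wge0// mulr_ge0.
Qed.

(** Convergence in the modulus topology, where the radii are themselves positive
    complex numbers: such a radius is real. *)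
Lemma cvg_complex (u : nat -> R[i]) (x y : R) :
  Re (u n) @[n --> \oo] --> x -> Im (u n) @[n --> \oo] --> y ->
  (u : nat -> C) @ \oo --> (x +i* y : C).
Proof.
move=> ux uy; apply/cvgrPdist_le => e e0.
have [eR ei] : 0 < Re e /\ e = (Re e)%:C.
  by move: e e0 => [p q]; rewrite ltcE/= => /andP[/eqP -> ->].
have e2 : 0 < Re e / 2 by rewrite divr_gt0.
near=> n.
rewrite ei normc_def lecR -normc_sqrtE.
apply: (le_trans (normc_le_ReIm _)).
rewrite [leRHS](splitr (Re e)) lerD//.
  have -> : Re ((x +i* y) - u n) = x - Re (u n) by case: (u n).
  by near: n; move/cvgrPdist_le : ux; exact.
have -> : Im ((x +i* y) - u n) = y - Im (u n) by case: (u n).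
by near: n; move/cvgrPdist_le : uy; exact.
Unshelve. all: end_near. Qed.

Lemma cvg_series_complex a : cvgn (series (normc \o a)) ->
  series (a : nat -> C) @ \oo -->
    (limn (series (Re \o a)) +i* limn (series (Im \o a)) : C).
Proof.
move=> ca; apply: cvg_complex.
  rewrite (_ : (fun n => _) = series (Re \o a)); last first.
    by apply/funext => n; exact: Re_sum.
  by apply: cvg_series_dominated ca => n; exact: normr_Re_le.
rewrite (_ : (fun n => _) = series (Im \o a)); last first.
  by apply/funext => n; exact: Im_sum.
by apply: cvg_series_dominated ca => n; exact: normr_Im_le.
Qed.

(** The real counterpart of [zsum], cut at the same place, so that [zsum] is
    computed componentwise ([zsumE]). *)
Definition zlim (b : int -> R) : R :=
  limn (series (b \o Posz)) + limn (series (b \o Negz)).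

Definition zcvg (b : int -> R) : Prop :=
  cvgn (series (b \o Posz)) /\ cvgn (series (b \o Negz)).

Lemma zcvg_le (b c : int -> R) : (forall n, `|b n| <= c n) -> zcvg c -> zcvg b.
Proof.
by move=> bc [cP cN]; split;
  [apply: cvg_series_dominated cP|apply: cvg_series_dominated cN] => n; exact: bc.
Qed.

Lemma zcvgZ (c : R) (b : int -> R) : zcvg b -> zcvg (fun n => c * b n).
Proof. by move=> [bP bN]; split; exact: is_cvg_seriesZ. Qed.

Lemma zlim_norm_le (b c : int -> R) :
  (forall n, `|b n| <= c n) -> zcvg c -> `|zlim b| <= zlim c.
Proof.
move=> bc [cP cN]; apply: le_trans (ler_normD _ _) _.
by apply: lerD; apply: norm_lim_series_le => // n; exact: bc.
Qed.

Lemma zsumE (a : int -> R[i]) : zcvg (normc \o a) ->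
  zsum a = zlim (Re \o a) +i* zlim (Im \o a).
Proof.
move=> [aP aN]; rewrite /zsum.
have hC : hausdorff_space C by exact: norm_hausdorff.
by rewrite (cvg_lim hC (cvg_series_complex aP)) (cvg_lim hC (cvg_series_complex aN)).
Qed.

Lemma zsumZ (c : R[i]) (a : int -> R[i]) : zcvg (normc \o a) ->
  zsum (fun n => c * a n) = c * zsum a.
Proof.
move=> [aP aN]; rewrite /zsum mulrDr.
have hC : hausdorff_space C by exact: norm_hausdorff.
have cP : cvgn (series ((fun n : nat => a (Posz n)) : nat -> C)).
  by apply: cvgP; exact: (cvg_series_complex aP).
have cN : cvgn (series ((fun n : nat => a (Negz n)) : nat -> C)).
  by apply: cvgP; exact: (cvg_series_complex aN).
congr (_ + _).
- exact: (lim_seriesZ (c : C) cP).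
- exact: (lim_seriesZ (c : C) cN).
Qed.

(** The factor 2 comes from bounding the modulus by the sum of the two
    components. *)
Lemma normc_zsum_le (a : int -> R[i]) : zcvg (normc \o a) ->
  normc (zsum a) <= 2 * zlim (normc \o a).
Proof.
move=> az; rewrite zsumE//; apply: le_trans (normc_le_ReIm _) _ => /=.
rewrite mulr_natl mulr2n; apply: lerD; apply: zlim_norm_le => // n /=.
  exact: normr_Re_le.
exact: normr_Im_le.
Qed.

(** Each half of the series is a sum over the range of an injection into the
    integers, hence is below the unordered sum. *)
Lemma zcvg_abs_summable (a : int -> R[i]) : abs_summable a -> zcvg (normc \o a).
Proof.
move=> sa.
have half (s : nat -> int) : injective s -> cvgn (series (fun n => normc (a (s n)))).
  move=> sI; apply: nnseries_is_cvg; first by move=> n; exact: normc_ge0.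
  apply: le_lt_trans sa.
  rewrite nneseries_esumT; last by move=> n; rewrite lee_fin normc_ge0.
  rewrite -(@reindex_esum _ _ _ setT (range s) s (fun n => (normc (a n))%:E)); last first.
    split; [by []|by move=> x y _ _; exact: sI|by []].
  rewrite esum_mkcond; apply: le_esum => n _.
  by case: ifP => // _; rewrite lee_fin normc_ge0.
by split; apply: half => x y [].
Qed.

Section ComplexIntegral.
Context d (T : measurableType d) (mu : {measure set T -> \bar R}).

Lemma Rintegral_zlim (g h : int -> T -> R) :
  (forall n, measurable_fun setT (g n)) ->
  (forall n x, `|g n x| <= h n x) ->
  (forall n, mu.-integrable setT (EFin \o h n)) ->
  (forall x, zcvg (h ^~ x)) ->
  zcvg (fun n => \int[mu]_x h n x) ->
  mu.-integrable setT (EFin \o (fun x => zlim (g ^~ x))) /\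
  \int[mu]_x zlim (g ^~ x) = zlim (fun n => \int[mu]_x g n x).
Proof.
move=> mg gh ih ch [cP cN].
have [iP eP] := @integral_series_dominated _ _ _ mu (g \o Posz) (h \o Posz)
  (fun=> mg _) (fun _ => gh _) (fun=> ih _) (fun x => (ch x).1) cP.
have [iN eN] := @integral_series_dominated _ _ _ mu (g \o Negz) (h \o Negz)
  (fun=> mg _) (fun _ => gh _) (fun=> ih _) (fun x => (ch x).2) cN.
split.
  by have := integrableD measurableT iP iN.
by rewrite /zlim RintegralD// eP eN.
Qed.

Lemma cintegral_zsum (g : int -> T -> R[i]) (h : int -> T -> R) :
  (forall n, cintegrable mu setT (g n)) ->
  (forall n x, normc (g n x) <= h n x) ->
  (forall n, mu.-integrable setT (EFin \o h n)) ->
  (forall x, zcvg (h ^~ x)) ->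
  zcvg (fun n => \int[mu]_x h n x) ->
  cintegrable mu setT (fun x => zsum (g ^~ x)) /\
  cintegral mu setT (fun x => zsum (g ^~ x)) =
    zsum (fun n => cintegral mu setT (g n)).
Proof.
move=> ig gh ih ch cih.
have [iR eR] := @Rintegral_zlim (fun n x => Re (g n x)) h
  (fun n => (measurable_EFinP _ _).1 (measurable_int _ (ig n).1))
  (fun n x => le_trans (normr_Re_le _) (gh n x)) ih ch cih.
have [iI eI] := @Rintegral_zlim (fun n x => Im (g n x)) h
  (fun n => (measurable_EFinP _ _).1 (measurable_int _ (ig n).2))
  (fun n x => le_trans (normr_Im_le _) (gh n x)) ih ch cih.
have gE x : zsum (g ^~ x) =
    zlim (fun n => Re (g n x)) +i* zlim (fun n => Im (g n x)).
  by rewrite zsumE//; apply: zcvg_le (ch x) => n /=; rewrite ger0_norm ?normc_ge0//; exact: gh.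
have -> : (fun x => zsum (g ^~ x)) = fun x =>
    zlim (fun n => Re (g n x)) +i* zlim (fun n => Im (g n x)).
  by apply/funext.
split; first by split.
rewrite /cintegral eR eI zsumE//.
apply: zcvg_le (zcvgZ 2 cih) => n.
rewrite ger0_norm; last exact: normc_ge0.
apply: le_trans (normc_le_ReIm _) _ => /=.
rewrite mulr_natl mulr2n.
have le_h (f : T -> R) : mu.-integrable setT (EFin \o f) ->
    (forall x, `|f x| <= h n x) -> `|\int[mu]_x f x| <= \int[mu]_x h n x.
  move=> intf fh; apply: le_trans (le_normr_Rintegral _ intf) _ => //.
  apply: le_Rintegral => //.
  exact: integrable_abse intf.
apply: lerD; apply: le_h.
- exact: (ig n).1.
- by move=> x; exact: le_trans (normr_Re_le _) (gh n x).
- exact: (ig n).2.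
- by move=> x; exact: le_trans (normr_Im_le _) (gh n x).
Qed.

Lemma cintegralZ (c : R[i]) (f : T -> R[i]) : cintegrable mu setT f ->
  cintegrable mu setT (fun x => c * f x) /\
  cintegral mu setT (fun x => c * f x) = c * cintegral mu setT f.
Proof.
move=> [iR iI].
have iZ (r : R) (f0 : T -> R) : mu.-integrable setT (EFin \o f0) ->
    mu.-integrable setT (EFin \o (fun x => r * f0 x)).
  by move=> i0; have := integrableZl measurableT r i0.
have iRR := iZ (Re c) _ iR. have iRI := iZ (Re c) _ iI.
have iIR := iZ (Im c) _ iR. have iII := iZ (Im c) _ iI.
have eR : (fun x => Re (c * f x)) = fun x => Re c * Re (f x) - Im c * Im (f x).
  by apply/funext => x; exact: Re_mulc.
have eI : (fun x => Im (c * f x)) = fun x => Re c * Im (f x) + Im c * Re (f x).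
  by apply/funext => x; exact: Im_mulc.
split.
  split.
    rewrite (_ : (fun x => _) = EFin \o (fun x => Re (c * f x)))// eR.
    by have := integrableB measurableT iRR iII.
  rewrite (_ : (fun x => _) = EFin \o (fun x => Im (c * f x)))// eI.
  by have := integrableD measurableT iRI iIR.
rewrite /cintegral eR eI RintegralB// RintegralD// !RintegralZl//.
by apply/eqP; rewrite eq_complex /= Re_mulc Im_mulc /= !eqxx.
Qed.

End ComplexIntegral.
End ComplexSeries.

(** * Gaussian waves and their superpositions *)

Section GaussWave.
Context {R : realType}.
Notation mu := (@lebesgue_measure R).
Implicit Types (z w : R[i]) (s m q k x : R).

Lemma cexpD z w : cexp (z + w) = cexp z * cexp w.
Proof.
apply/eqP; rewrite eq_complex Re_mulc Im_mulc /cexp /= Re_addc Im_addc expRD cosD sinD.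
by apply/andP; split; apply/eqP; ring.
Qed.

Lemma normc_cexp z : normc (cexp z) = expR (Re z).
Proof.
rewrite normc_sqrtE /cexp /= !exprMn -mulrDr cos2Dsin2 mulr1 sqrtr_sqr.
by rewrite ger0_norm// expR_ge0.
Qed.

Lemma cexp_real x : cexp (x +i* 0) = (expR x)%:C.
Proof. by rewrite /cexp /= cos0 sin0 mulr1 mulr0. Qed.

(** Periodicity, which cancels the phase mixing the two summation indices. *)
Lemma cexp_2pi_int (n : int) : cexp (0 +i* (2 * pi * n%:~R)) = 1 :> R[i].
Proof.
have e1 : cexp (0 +i* (2 * pi)) = 1 :> R[i].
  by rewrite /cexp /= expR0 !mul1r mulr_natl cos2pi sin2pi.
have eN (j : nat) : cexp (0 +i* (2 * pi * j%:R)) = 1 :> R[i].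
  elim: j => [|j IH]; first by rewrite mulr0 cexp_real expR0.
  rewrite (_ : 0 +i* _ = 0 +i* (2 * pi * j%:R) + 0 +i* (2 * pi)).
    by rewrite cexpD IH e1 mulr1.
  by apply/eqP; rewrite eq_complex Re_addc Im_addc /= addr0 -[j.+1%:R]natr1 mulrDr mulr1 !eqxx.
case: n => j; first exact: eN.
rewrite NegzE -[LHS]mulr1 -(eN j.+1) -cexpD.
rewrite (_ : _ + _ = 0 +i* 0); first by rewrite cexp_real expR0.
apply/eqP; rewrite eq_complex Re_addc Im_addc /= addr0 eqxx/=.
by rewrite mulrNz mulrN -pmulrn addNr.
Qed.

Definition gauss_wave s m x : R[i] := cexp ((- (x - s) ^+ 2) +i* (2 * m * x)).

Lemma normc_gauss_wave s m x : normc (gauss_wave s m x) = gauss_fun (x - s).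
Proof. exact: normc_cexp. Qed.

(** Re-centring the phase, [2 m x = 2 m (x - s) + 2 m s], brings the real part
    to [gauss_cosE]; the imaginary part is the same with the phase shifted by
    [- pi / 2]. *)
Lemma cintegral_gauss_wave s m :
  cintegrable mu setT (gauss_wave s m) /\
  cintegral mu setT (gauss_wave s m) =
    (Num.sqrt pi * gauss_fun m)%:C * cexp (0 +i* (2 * m * s)).
Proof.
have eR : (fun x => Re (gauss_wave s m x)) =
    fun x => gauss_fun (x - s) * cos (2 * m * (x - s) + 2 * m * s).
  by apply/funext => x /=; congr (_ * cos _); ring.
have eI : (fun x => Im (gauss_wave s m x)) =
    fun x => gauss_fun (x - s) * cos (2 * m * (x - s) + (2 * m * s - pi / 2)).
  apply/funext => x /=; rewrite addrA cosBpihalf; congr (_ * sin _); ring.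
split.
  split.
    rewrite (_ : (fun x => _) = EFin \o (fun x => Re (gauss_wave s m x)))// eR.
    exact: integrable_gauss_cos.
  rewrite (_ : (fun x => _) = EFin \o (fun x => Im (gauss_wave s m x)))// eI.
  exact: integrable_gauss_cos.
rewrite /cintegral eR eI.
have := gauss_cosE s (2 * m * s) m; rewrite /gauss_cos => ->.
have := gauss_cosE s (2 * m * s - pi / 2) m; rewrite /gauss_cos => ->.
rewrite cosBpihalf; apply/eqP; rewrite eq_complex Re_mulc Im_mulc /= expR0.
by apply/andP; split; apply/eqP; ring.
Qed.

(** The exchange used for both summations: the centres [s n] may vary with [n],
    since neither the maximum nor the mass of a Gaussian depends on its centre. *)
Lemma cintegral_zsum_gauss (b s : int -> R) (g : int -> R -> R[i]) :
  zcvg b -> (forall n, cintegrable mu setT (g n)) ->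
  (forall n x, normc (g n x) <= b n * gauss_fun (x - s n)) ->
  cintegrable mu setT (fun x => zsum (g ^~ x)) /\
  cintegral mu setT (fun x => zsum (g ^~ x)) =
    zsum (fun n => cintegral mu setT (g n)).
Proof.
move=> cb ig gb.
have b0 n : 0 <= b n.
  have := le_trans (normc_ge0 _) (gb n 0).
  by rewrite pmulr_lge0// expR_gt0.
apply: (@cintegral_zsum _ _ _ mu g (fun n x => b n * gauss_fun (x - s n))) => //.
- move=> n.
  by have := integrableZl measurableT (b n) (integrable_gauss_funB (s n)).
- move=> x; apply: zcvg_le cb => n.
  rewrite ger0_norm; last by rewrite mulr_ge0// gauss_fun_ge0.
  by rewrite ler_piMr// gauss_fun_le1.
- apply: zcvg_le (zcvgZ (Num.sqrt pi) cb) => n.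
  rewrite RintegralZl//; last exact: integrable_gauss_funB.
  rewrite Rintegral_gauss_funB mulrC ger0_norm//.
  by rewrite mulr_ge0// sqrtr_ge0.
Qed.

Lemma zcvg_psi (v : R -> int -> R[i]) x q : abs_summable (v q) ->
  zcvg (normc \o (fun n => v q n * cexp (0 +i* (2 * q * n%:~R * x)))).
Proof.
move=> /zcvg_abs_summable; congr zcvg; apply/funext => n.
by rewrite /comp ComplexField.Normc.normcM normc_cexp expR0 mulr1.
Qed.

Lemma normc_psi_le (v : R -> int -> R[i]) x q : abs_summable (v q) ->
  normc (psi v x q) <= 2 * zlim (normc \o v q).
Proof.
move=> sv; apply: le_trans (normc_zsum_le (zcvg_psi x sv)) _.
rewrite le_eqVlt; apply/orP; left; apply/eqP; congr (_ * zlim _).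
apply/funext => n.
by rewrite /comp ComplexField.Normc.normcM normc_cexp expR0 mulr1.
Qed.

(** Completing the square bounds the exponent by [x^2], uniformly in [n]. *)
Lemma zcvg_phi (u : R -> int -> R[i]) x k : abs_summable (u k) ->
  zcvg (normc \o (fun n => u k n *
    (expR (- (k ^+ 2 * n%:~R ^+ 2) + 2 * k * n%:~R * x))%:C)).
Proof.
move=> /zcvg_abs_summable /(zcvgZ (expR (x ^+ 2))); apply: zcvg_le => n.
rewrite ger0_norm; last exact: normc_ge0.
rewrite /comp ComplexField.Normc.normcM -cexp_real normc_cexp mulrC.
apply: ler_wpM2r; first exact: normc_ge0.
rewrite ler_expR /=.
have := sqr_ge0 (k * n%:~R - x); nra.
Qed.

(** The inner summation: multiplying by the [l]-th wave of [psi v x q] only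
    shifts the frequency of [gauss_wave s m] by [q l]. *)
Lemma cintegral_gauss_wave_psi (v : R -> int -> R[i]) s m q :
  abs_summable (v q) ->
  cintegrable mu setT (fun x => gauss_wave s m x * psi v x q) /\
  cintegral mu setT (fun x => gauss_wave s m x * psi v x q) =
  zsum (fun l : int => v q l * ((Num.sqrt pi * gauss_fun (m + q * l%:~R))%:C *
    cexp (0 +i* (2 * (m + q * l%:~R) * s)))).
Proof.
move=> sv.
have -> : (fun x => gauss_wave s m x * psi v x q) =
    fun x => zsum (fun l : int => v q l * gauss_wave s (m + q * l%:~R) x).
  apply/funext => x; rewrite -zsumZ; last exact: zcvg_psi.
  congr zsum; apply/funext => l; rewrite mulrCA; congr (_ * _).
  rewrite /gauss_wave -cexpD; congr cexp.
  apply/eqP; rewrite eq_complex Re_addc Im_addc /= addr0 eqxx/=.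
  by apply/eqP; ring.
have iw l := @cintegralZ _ _ _ mu (v q l) _ (cintegral_gauss_wave s (m + q * l%:~R)).1.
have [||i e] := @cintegral_zsum_gauss (normc \o v q) (fun=> s)
  (fun l x => v q l * gauss_wave s (m + q * l%:~R) x) (zcvg_abs_summable sv).
- by move=> l; exact: (iw l).1.
- by move=> l x; rewrite ComplexField.Normc.normcM normc_gauss_wave.
split => //; rewrite e; congr zsum; apply/funext => l.
by rewrite (iw l).2 (cintegral_gauss_wave _ _).2.
Qed.

End GaussWave.

Theorem proposition1 (R : realType) (k : R) (hk : k != 0)
    (u v : R -> int -> R[i])
    (hu : forall q : R, abs_summable (u q))
    (hv : forall q : R, abs_summable (v q))
    (m : R) :
  let f := fun x : R =>
    cexp ((- x ^+ 2) +i* (2 * m * x)) * phi u x k * psi v x (pi / k) in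
  cintegrable lebesgue_measure [set: R] f /\
  cintegral lebesgue_measure [set: R] f =
    (Num.sqrt pi * expR (- m ^+ 2))%:C * phi v (- m) (pi / k) * psi u m k.
Proof.
move=> f; set q := pi / k; set mu := lebesgue_measure.
(* w n collects everything in the n-th term except the coefficient u k n. *)
pose w n x := gauss_wave (k * n%:~R) m x * psi v x q.
have fE : f = fun x => zsum (fun n => u k n * w n x).
  apply/funext => x; rewrite /f mulrAC -zsumZ; last exact: zcvg_phi.
  congr zsum; apply/funext => n.
  have -> : w n x = cexp ((- x ^+ 2) +i* (2 * m * x)) * psi v x q *
      (expR (- (k ^+ 2 * n%:~R ^+ 2) + 2 * k * n%:~R * x))%:C.
    rewrite /w mulrAC -cexp_real -cexpD; congr (cexp _ * _).
    apply/eqP; rewrite eq_complex Re_addc Im_addc /= addr0 eqxx andbT.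
    by apply/eqP; ring.
  by rewrite mulrCA.
have wE n : cintegral mu setT (w n) =
    ((Num.sqrt pi * expR (- m ^+ 2))%:C * phi v (- m) q) *
      cexp (0 +i* (2 * k * n%:~R * m)).
  rewrite (cintegral_gauss_wave_psi _ _ (hv q)).2 mulrAC -zsumZ; last exact: zcvg_phi.
  congr zsum; apply/funext => l.
  (* As q * k = pi, the two phases differ by 2 pi l n. *)
  have -> : cexp (0 +i* (2 * (m + q * l%:~R) * (k * n%:~R))) =
      cexp (0 +i* (2 * k * n%:~R * m)) :> R[i].
    rewrite -[RHS]mulr1 -(@cexp_2pi_int R (l * n)) -cexpD; congr cexp.
    apply/eqP; rewrite eq_complex Re_addc Im_addc /= addr0 eqxx/= intrM /q.
    by apply/eqP; field.
  have -> : (Num.sqrt pi * gauss_fun (m + q * l%:~R))%:C =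
      (Num.sqrt pi * expR (- m ^+ 2))%:C *
      (expR (- (q ^+ 2 * l%:~R ^+ 2) + 2 * q * l%:~R * - m))%:C.
    rewrite -rmorphM /=; congr (_%:C).
    by rewrite -[RHS]mulrA -expRD; congr (_ * expR _); ring.
  ring.
have iw n := @cintegralZ _ _ _ mu (u k n) _
  (cintegral_gauss_wave_psi (k * n%:~R) m (hv q)).1.
(* V bounds psi v x q uniformly in x. *)
pose V := 2 * zlim (normc \o v q).
have [||i e] := @cintegral_zsum_gauss _ (fun n => V * normc (u k n))
  (fun n => k * n%:~R) (fun n x => u k n * w n x)
  (zcvgZ V (zcvg_abs_summable (hu k))).
- by move=> n; exact: (iw n).1.
- move=> n x; rewrite !ComplexField.Normc.normcM normc_gauss_wave.
  rewrite [leRHS]mulrAC [leRHS]mulrC; apply: ler_wpM2l; first exact: normc_ge0.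
  rewrite [leRHS]mulrC; apply: ler_wpM2l; first exact: gauss_fun_ge0.
  exact: normc_psi_le.
rewrite fE; split => //; rewrite e.
rewrite -zsumZ; last exact: zcvg_psi.
congr zsum; apply/funext => n.
by rewrite (iw n).2 wE mulrCA.
Qed.
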